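(* Let $k\geq l\geq 1$ and let $\widetilde T_{k,l}$ be the set of families of positive integers $T=(a_i,b_i)_{1\leq i\leq k-l}$ such that $a_i\leq b_i\leq l+i-1$ for all $i$, and $a_i<b_{i+1}$ for $1\leq i<k-l$ (these are the column-strict reverse plane partitions of skew shape $(k-l+1,k-l,\ldots,2)/(k-l-1,k-l-2,\ldots,0)$ with positive entries, row $i$ having entries $a_i,b_i$ from left to right, with largest entry in row $i$ at most $l+i-1$). Put $|T|=\sum_{i=1}^{k-l}(a_i+b_i)$. Then $$d_{k,l}(q)=\sum_{T\in\widetilde T_{k,l}}q^{-2(k-l)+|T|}.$$
   Context: For $m\in\mathbb Z$, $r\in\mathbb N$: $(x;q)_r=(1-x)(1-xq)\cdots(1-xq^{r-1})$ and ${m\brack r}_q=\frac{(q^{m-r+1};q)_r}{(q;q)_r}$. Let $H_q$ be the lower unitriangular matrix with $(H_q)_{i,j}={-j\brack 2i-2j}_q\,q^{(i-j)(2i-1)}$ $(={2i-j-1\brack 2i-2j}_q)$ for $j\leq i$ and $0$ for $j>i$, and $H_q^{-1}=((-1)^{i-j}d_{i,j}(q))_{i,j\geq 1}$. A column-strict reverse plane partition of a skew shape is a filling of its cells weakly increasing from left to right along rows and strictly increasing from top to bottom along (geometric) columns; in the shape above the left cell of row $i$ and the right cell of row $i+1$ lie in the same column. *)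

(* Defs.v *)
From mathcomp Require Import all_boot all_order all_algebra.
From mathcomp Require Import ring zify.

Set Implicit Arguments.
Unset Strict Implicit.
Unset Printing Implicit Defensive.

Import Order.TTheory GRing.Theory Num.Theory.
Local Open Scope ring_scope.

(* The indeterminate q, in the field Q(q). *)
Definition Qq : fieldType := {fraction {poly rat}}.
Definition qvar : Qq := tofrac ('X : {poly rat}).

Definition qpoch (F : fieldType) (q x : F) (r : nat) : F :=
  \prod_(s < r) (1 - x * q ^+ s).

Definition qbinom (F : fieldType) (q : F) (m : int) (r : nat) : F :=
  qpoch q (q ^ (m - r%:Z + 1)) r / qpoch q q r.

(* Infinite matrices are functions nat -> nat -> F whose entries are relevant
   only at row and column indices >= 1. *)
Definition lower_triangular (F : fieldType) (A : nat -> nat -> F) : Prop :=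
  forall i j : nat, (0 < i)%N -> (i < j)%N -> A i j = 0.

(* The product A B when A is lower triangular: the terms with m > i vanish. *)
Definition ltmul (F : fieldType) (A B : nat -> nat -> F) (i j : nat) : F :=
  \sum_(1 <= m < i.+1) A i m * B m j.

Definition ltinverse (F : fieldType) (A B : nat -> nat -> F) : Prop :=
  [/\ lower_triangular A, lower_triangular B,
      forall i j : nat, (0 < i)%N -> (0 < j)%N -> ltmul A B i j = (i == j)%:R
    & forall i j : nat, (0 < i)%N -> (0 < j)%N -> ltmul B A i j = (i == j)%:R].

Definition Hq (F : fieldType) (q : F) (i j : nat) : F :=
  if (j <= i)%N
  then qbinom q (- j%:Z) (2 * i - 2 * j)
         * q ^ ((i%:Z - j%:Z) * (2 * i%:Z - 1))
  else 0.

(* With i : 'I_(k - l) counted from 0, T i is the pair (a_{i+1}, b_{i+1}), so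
   the bound l + i - 1 becomes l + i.  Taking values in 'I_k loses no family,
   as a_i <= b_i <= l + (k - l) - 1 < k. *)
Definition Ttilde (k l : nat) : {set {ffun 'I_(k - l) -> 'I_k * 'I_k}} :=
  [set T : {ffun 'I_(k - l) -> 'I_k * 'I_k} |
    [forall i : 'I_(k - l), [&& (0 < (T i).1)%N, ((T i).1 <= (T i).2)%N
                                & ((T i).2 <= l + i)%N]] &&
    [forall i : 'I_(k - l), forall j : 'I_(k - l),
       (j == i.+1 :> nat) ==> ((T i).1 < (T j).2)%N]].

Definition weight (k l : nat) (T : {ffun 'I_(k - l) -> 'I_k * 'I_k}) : nat :=
  (\sum_(i < k - l) ((T i).1 + (T i).2))%N.

Lemma qvar_neq0 : qvar != 0.
Proof. by rewrite /qvar tofrac_eq0 polyX_eq0. Qed.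

Lemma qvar_exp_neq1 (n : nat) : (0 < n)%N -> qvar ^+ n != 1.
Proof.
move=> n0; rewrite /qvar -tofracXn -tofrac1 tofrac_eq -subr_eq0.
by rewrite -size_poly_gt0 size_XnsubC.
Qed.

(* The other usual form of the entries of Hq. *)
Lemma HqE (F : fieldType) (q : F) (i j : nat) :
  q != 0 -> (0 < j)%N -> (j <= i)%N ->
  Hq q i j = qbinom q (2 * i%:Z - j%:Z - 1) (2 * i - 2 * j).
Proof.
move=> q0 j0 ji; rewrite /Hq ji /qbinom mulrAC; congr (_ / _).
have [n ->] : exists n, i = (j + n)%N by exists (i - j)%N; lia.
have -> : (2 * (j + n) - 2 * j = 2 * n)%N by lia.
have -> : ((j + n)%:Z - j%:Z) * (2 * (j + n)%:Z - 1)
          = \sum_(s < 2 * n) (j + s)%:Z.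
  elim: n {ji} => [|n IH]; first by rewrite muln0 big_ord0; lia.
  have -> : (2 * n.+1 = (2 * n).+2)%N by lia.
  rewrite !big_ord_recr /= -IH; lia.
have Xsum (f : 'I_(2 * n) -> int) : q ^ (\sum_s f s) = \prod_s q ^ (f s).
  by elim/big_rec2: _ => [|s x y _ <-]; rewrite ?expr0z // expfzDr.
rewrite Xsum /qpoch (reindex_inj rev_ord_inj) /= -big_split /=.
transitivity (\prod_(s < 2 * n) (- (1 - q ^ (j + s)%:Z))).
  apply: eq_bigr => s _; rewrite exprnP -expfzDr //.
  rewrite mulrBl mul1r -expfzDr // opprB; congr (_ - _).
  rewrite -(expr0z q); congr (_ ^ _); have := ltn_ord s; lia.
rewrite prodrN card_ord exprM sqrrN !expr1n mul1r.
apply: eq_bigr => s _; rewrite exprnP -expfzDr //.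
by congr (_ - _ ^ _); lia.
Qed.

Fixpoint ltrows (F : fieldType) (A : nat -> nat -> F) (n i j : nat) : F :=
  if n is n'.+1 then
    if i == n then (i == j)%:R - \sum_(1 <= m < n) A n m * ltrows A n' m j
    else ltrows A n' i j
  else 0.

Lemma ltinverse_exists (F : fieldType) (A : nat -> nat -> F) :
  lower_triangular A -> (forall i, (0 < i)%N -> A i i = 1) ->
  exists B, ltinverse A B.
Proof.
move=> At A1.
have st n m j : (m <= n)%N -> ltrows A n m j = ltrows A m m j.
  elim: n => [|n IH] mn; first by have -> : m = 0%N by lia.
  move: mn; rewrite leq_eqVlt => /orP[/eqP -> //|mn] /=.
  by rewrite ltn_eqF // IH.
pose B i j := ltrows A i i j.
have BE i j : (0 < i)%N ->
   B i j = (i == j)%:R - \sum_(1 <= m < i) A i m * B m j.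
  case: i => // i _; rewrite /B /= eqxx; congr (_ - _).
  by apply: eq_big_nat => m /andP[_ mi]; rewrite st.
have Bt : lower_triangular B.
  move=> i; elim/ltn_ind: i => i IH j i0 ij.
  rewrite BE // ltn_eqF // big_nat_cond big1 ?subr0 // => m /andP[/andP[m0 mi] _].
  by rewrite IH ?mulr0 //; apply: ltn_trans ij.
have AB i j : (0 < i)%N -> (0 < j)%N -> ltmul A B i j = (i == j)%:R.
  move=> i0 _; rewrite /ltmul big_nat_recr //= A1 // mul1r [B i j]BE //.
  by rewrite addrC subrK.
have trunc (C D : nat -> nat -> F) n (i j : 'I_n) : lower_triangular C ->
   ((\matrix_(a < n, b < n) C a.+1 b.+1) *m (\matrix_(a < n, b < n) D a.+1 b.+1)) i j
   = ltmul C D i.+1 j.+1.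
  move=> Ct; rewrite mxE /ltmul.
  under eq_bigr do rewrite !mxE.
  rewrite -(big_mkord xpredT (fun m => C i.+1 m.+1 * D m.+1 j.+1)).
  rewrite big_add1 (big_cat_nat (n := i.+1)) //= [X in _ + X]big_nat_cond.
  rewrite [X in _ + X]big1 ?addr0 // => m /andP[/andP[im _] _].
  by rewrite Ct ?mul0r.
exists B; split=> // -[|i] [|j] // _ _.
pose n := (maxn i j).+1.
have In : (i < n)%N by rewrite ltnS leq_maxl.
have Jn : (j < n)%N by rewrite ltnS leq_maxr.
rewrite -(trunc B A n (Ordinal In) (Ordinal Jn)) // mulmx1C ?mxE //.
by apply/matrixP => a b; rewrite trunc // AB // mxE.
Qed.

Lemma Hq_lower_triangular (F : fieldType) (q : F) : lower_triangular (Hq q).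
Proof. by move=> i j _ ij; rewrite /Hq leqNgt ij. Qed.

Lemma Hq_diag (F : fieldType) (q : F) (i : nat) : Hq q i i = 1.
Proof.
by rewrite /Hq leqnn subnn subrr mul0r expr0z mulr1 /qbinom /qpoch !big_ord0 divr1.
Qed.

Lemma Hq_inverse_exists :
  exists d : nat -> nat -> Qq,
    ltinverse (Hq qvar) (fun i j : nat => (-1) ^ (i%:Z - j%:Z) * d i j).
Proof.
have [B [At Bt AB BA]] :=
  ltinverse_exists (@Hq_lower_triangular _ qvar) (fun i _ => Hq_diag qvar i).
exists (fun i j => (-1) ^ (i%:Z - j%:Z) * B i j).
have E i j : (-1) ^ (i%:Z - j%:Z) * ((-1) ^ (i%:Z - j%:Z) * B i j) = B i j.
  by rewrite mulrA -exprzMl ?unitrN1 // mulrNN mulr1 exp1rz mul1r.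
split=> // [i j i0 ij|i j i0 j0|i j i0 j0]; first by rewrite E Bt.
- by rewrite -AB //; apply: eq_bigr => m _; rewrite E.
- by rewrite -BA //; apply: eq_bigr => m _; rewrite E.
Qed.

(* Main.v *)
(** The entry [Hq (l + r) l] is the sum of [q ^ sum (x_i - 1)] over the chains
    [1 <= x_1 <= ... <= x_{2r} <= l].  Replacing each condition [a_i < b_{i+1}]
    by the absence of a condition minus [b_{i+1} <= a_i] glues each maximal run
    of rows into one such chain
    [a_{i+r-1} <= b_{i+r-1} <= ... <= a_i <= b_i <= l + i - 1], so the sum over
    runs is an entry of [Hq].  Splitting off the first run is exactly the
    recurrence satisfied by the signed entries of the inverse matrix. *)
Require Import Defs.
From mathcomp Require Import all_boot all_order all_algebra.
From mathcomp Require Import ring zify.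

Set Implicit Arguments.
Unset Strict Implicit.
Unset Printing Implicit Defensive.

Import Order.TTheory GRing.Theory Num.Theory.
Local Open Scope ring_scope.

(** * Iterated q-sums over chains *)

Section QSum.

Variables (F : fieldType) (q : F).

(** The index is the entry minus one, so an entry [x] in [1..c] weighs [q ^+ (x - 1)]. Iteration
    sums over weakly decreasing chains starting at most at [c]. *)
Definition qsum (f : nat -> F) (c : nat) : F := \sum_(x < c) q ^+ x * f x.+1.

Lemma eq_qsum f g c :
  (forall x, (0 < x <= c)%N -> f x = g x) -> qsum f c = qsum g c.
Proof. by move=> fg; apply: eq_bigr => x _; rewrite fg ?ltn_ord. Qed.

Lemma qsum_linear (y : F) f g c :
  qsum (fun x => y * f x - g x) c = y * qsum f c - qsum g c.
Proof.
rewrite /qsum mulr_sumr -sumrB; apply: eq_bigr => x _; ring.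
Qed.

Lemma eq_iter_qsum s f g c :
  (forall x, (x <= c)%N -> f x = g x) -> iter s qsum f c = iter s qsum g c.
Proof.
move=> fg; elim: s c fg => [|s IH] c fg /=; first exact: fg.
apply: eq_qsum => x /andP[_ xc]; apply: IH => y yx; apply: fg.
exact: leq_trans xc.
Qed.

Lemma iter_qsum_linear s (y : F) f g c :
  iter s qsum (fun x => y * f x - g x) c
  = y * iter s qsum f c - iter s qsum g c.
Proof.
elim: s c => //= s IH c; rewrite -qsum_linear.
by apply: eq_qsum => x _; rewrite IH.
Qed.

(** The two products share the factors [1 - q ^+ (c + i)] for [1 <= i <= s]; only the extreme
    factors are subtracted. This is a form of the q-Pascal rule. *)
Lemma qpoch_diff c s :
  qpoch q (q ^+ c.+1) s.+1 - qpoch q (q ^+ c) s.+1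
  = q ^+ c * (1 - q ^+ s.+1) * qpoch q (q ^+ c.+1) s.
Proof.
rewrite /qpoch [X in X - _]big_ord_recr [X in _ - X]big_ord_recl /= expr0 mulr1.
have -> : \prod_(i < s) (1 - q ^+ c * q ^+ bump 0 i)
          = \prod_(i < s) (1 - q ^+ c.+1 * q ^+ i).
  by apply: eq_bigr => i _; rewrite -!exprD addSnnS.
rewrite !exprS; ring.
Qed.

(** By [qpoch_diff] the increment in [c] of the closed form is the last term of the outer sum, so
    the sum telescopes. *)
Lemma iter_qsum1 s c : (forall n, (0 < n)%N -> q ^+ n != 1) ->
  iter s qsum (fun=> 1) c = qpoch q (q ^+ c) s / qpoch q q s.
Proof.
move=> q1.
elim: s c => [|s IH] c /=; first by rewrite /qpoch !big_ord0 divr1.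
elim: c => [|c IHc].
  by rewrite /qsum big_ord0 /qpoch big_ord_recl /= mulr1 subrr !mul0r.
rewrite /qsum big_ord_recr /= -/(qsum _ c) IHc IH.
have E : qpoch q q s.+1 = qpoch q q s * (1 - q ^+ s.+1).
  by rewrite /qpoch big_ord_recr /= -exprS.
have n0 : 1 - q ^+ s.+1 != 0 by rewrite subr_eq0 eq_sym q1.
have p0 : qpoch q q s != 0.
  by apply/prodf_neq0 => i _; rewrite subr_eq0 eq_sym -exprS q1.
rewrite E -[qpoch q (q ^+ c.+1) s.+1](subrK (qpoch q (q ^+ c) s.+1)) qpoch_diff.
by field; rewrite n0.
Qed.

Lemma Hq_iter_qsum l r :
  q != 0 -> (forall n, (0 < n)%N -> q ^+ n != 1) -> (0 < l)%N ->
  Hq q (l + r) l = iter (2 * r) qsum (fun=> 1) l.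
Proof.
move=> q0 q1 l0; rewrite iter_qsum1 // HqE ?leq_addr // /qbinom.
have -> : (2 * (l + r) - 2 * l = 2 * r)%N by lia.
by congr (qpoch _ _ _ / _); rewrite exprnP; congr (_ ^ _); lia.
Qed.

(** * Gluing rows and the recurrence for the inverse *)

(* For [c <= N], the sum of [q ^ sum (a_i + b_i - 2)] over [n] rows [a_i <= b_i]
   whose bounds on [b_i] are [N, N + 1, ...], with [c < b_1] in addition to
   [a_i < b_{i+1}]: pairs [a <= b <= N] minus pairs [a <= b <= c]. *)
Fixpoint row_sum (n N c : nat) : F :=
  if n is n'.+1 then
    iter 2 qsum (row_sum n' N.+1) N - iter 2 qsum (row_sum n' N.+1) c
  else 1.

Lemma row_sumS0 n N : row_sum n.+1 N 0 = iter 2 qsum (row_sum n N.+1) N.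
Proof. by rewrite /= [X in _ - X]/qsum big_ord0 subr0. Qed.

(** Unfolding [row_sum] gives a constant, which starts a fresh run of rows, minus a term that
    prolongs the chain by two entries; [s] counts the rows glued on. The general [r] absorbs the two
    extra summations in the induction. *)
Lemma iter_qsum_row_sum n N r c : (c <= N)%N ->
  iter (2 * r) qsum (row_sum n N) c
  = \sum_(s < n.+1) (-1) ^+ s * row_sum (n - s) (N + s) 0
                     * iter (2 * (r + s)) qsum (fun=> 1) c.
Proof.
elim: n N r => [|n IH] N r cN.
  by rewrite big_ord1 /= mulr1 mul1r !addn0.
rewrite (@eq_iter_qsum _ _ (fun x => row_sum n.+1 N 0 * 1
                                     - iter 2 qsum (row_sum n N.+1) x)); last first.
  by move=> x _; rewrite row_sumS0 mulr1.
rewrite iter_qsum_linear -iterD -mulnSr IH ?leqW //.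
rewrite [in RHS]big_ord_recl expr0 mul1r subn0 !addn0; congr (_ + _).
rewrite -sumrN; apply: eq_bigr => s _.
by rewrite lift0 subSS addSnnS [(r.+1 + _)%N]addSnnS exprS mulN1r !mulNr.
Qed.

(** For positive [n] the term [s = 0] is a double q-sum, whose expansion by [iter_qsum_row_sum] with
    [r = 1] cancels the other terms one by one. *)
Lemma row_sum_recurrence l n :
  q != 0 -> (forall n, (0 < n)%N -> q ^+ n != 1) -> (0 < l)%N ->
  \sum_(s < n.+1) (-1) ^+ s * row_sum (n - s) (l + s) 0 * Hq q (l + s) l
  = (n == 0)%:R.
Proof.
move=> q0 q1 l0.
under eq_bigr => s _ do rewrite Hq_iter_qsum //.
case: n => [|n]; first by rewrite big_ord1 /= !mulr1.
rewrite big_ord_recl expr0 mul1r subn0 !addn0 muln0 /= mulr1.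
rewrite -[X in X + _]/(row_sum n.+1 l 0) row_sumS0 -[2%N]muln1.
rewrite iter_qsum_row_sum // -big_split big1 // => s _ /=.
by rewrite /bump leq0n !add1n subSS addSnnS exprS mulN1r !mulNr subrr.
Qed.

(** Both sides satisfy the same recurrence; the term [s = 0] has coefficient [Hq q l l = 1], and the
    others have a smaller difference of indices. *)
Lemma ltinverse_row_sum (d : nat -> nat -> F) k l :
  q != 0 -> (forall n, (0 < n)%N -> q ^+ n != 1) ->
  ltinverse (Hq q) (fun i j => (-1) ^ (i%:Z - j%:Z) * d i j) ->
  (0 < l <= k)%N -> d k l = row_sum (k - l) l 0.
Proof.
move=> q0 q1 [_ _ _ dH] /andP[l0 lk].
have {lk} [n ->] : exists n, k = (l + n)%N by exists (k - l)%N; lia.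
rewrite addKn; elim/ltn_ind: n l l0 => n IH l l0.
have := dH (l + n)%N l (ltn_addr _ l0) l0.
rewrite -[X in _ == X]addn0 eqn_add2l /ltmul.
rewrite (big_cat_nat (n := l)) //=; last by rewrite ltnW // ltnS leq_addr.
rewrite big_nat_cond big1 ?add0r; last first.
  by move=> m /andP[/andP[m0 ml] _]; rewrite (Hq_lower_triangular q m0 ml) mulr0.
rewrite -{1}[l]add0n big_addn subSn ?leq_addr // addKn big_mkord => E.
have {}E : \sum_(s < n.+1) (-1) ^+ s * d (l + n)%N (l + s)%N * Hq q (l + s) l
         = \sum_(s < n.+1) (-1) ^+ s * row_sum (n - s) (l + s) 0 * Hq q (l + s) l.
  rewrite row_sum_recurrence //.
  (* The signs [(-1) ^+ (n - s)] and [(-1) ^+ s] differ by the global factor [(-1) ^+ n], which is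
     harmless as the right side vanishes unless [n = 0]. *)
  have -> : (n == 0%N)%:R = (-1) ^+ n * (n == 0%N)%:R :> F.
    by case: (n) => [|m]; rewrite ?mulr0 // expr0 mul1r.
  rewrite -E mulr_sumr; apply: eq_bigr => s _; rewrite [(s + l)%N]addnC.
  have -> : (l + n)%N%:Z - (l + s)%N%:Z = (n - s)%N%:Z by have := ltn_ord s; lia.
  have sn : (s <= n)%N by rewrite -ltnS.
  have -> : (-1) ^+ s = (-1) ^+ n * (-1) ^+ (n - s) :> F.
    by rewrite -[in X in X * _](subnK sn) exprD mulrAC -expr2 sqrr_sign mul1r.
  by rewrite -exprnP !mulrA.
move: E; rewrite !big_ord_recl /= addn0 subn0 Hq_diag !mulr1 expr0 !mul1r.
set X := \sum_(_ < _) _; set Y := \sum_(_ < _) _.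
suff -> : X = Y by move/addIr.
apply: eq_bigr => s _; congr (_ * _ * _).
rewrite /bump leq0n !add1n; have := ltn_ord s => sn.
have := IH (n - s.+1)%N _ (l + s.+1)%N; rewrite -addnA subnKC // => -> //; lia.
Qed.

(** * Row sums as sums over fillings *)

(** The bound [c] stands for the left entry of a row above the first one, so that removing a row
    leaves a condition of the same kind. *)
Definition rows K n (N c : nat) (T : {ffun 'I_n -> 'I_K * 'I_K}) : bool :=
  [&& [forall i : 'I_n, [&& (0 < (T i).1)%N, ((T i).1 <= (T i).2)%N
                          & ((T i).2 <= N + i)%N]],
      [forall i : 'I_n, forall j : 'I_n,
         (j == i.+1 :> nat) ==> ((T i).1 < (T j).2)%N]
    & [forall i : 'I_n, (i == 0 :> nat) ==> (c < (T i).2)%N]].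

Lemma sum_ord_interval K c N (f : nat -> F) : (N < K)%N ->
  \sum_(b < K | (c < b <= N)%N) f b = \sum_(c <= b < N) f b.+1.
Proof.
move=> NK; rewrite -(big_mkord (fun b => (c < b <= N)%N) f).
rewrite -[RHS](big_add1 _ _ c N.+1 xpredT f) [RHS](big_nat_widen _ _ K) //.
by rewrite [RHS](big_nat_widenl _ 0) //; apply: eq_bigl => b; rewrite andbC.
Qed.

Lemma row_pair_sum K c N (f : nat -> F) : (c <= N < K)%N ->
  \sum_(x : 'I_K * 'I_K | [&& (0 < x.1)%N, (x.1 <= x.2)%N, (x.2 <= N)%N
                            & (c < x.2)%N])
     q ^+ (x.1.-1 + x.2.-1) * f x.1
  = iter 2 qsum f N - iter 2 qsum f c.
Proof.
move=> /andP[cN NK] /=; rewrite {1 3}/qsum.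
rewrite -!(big_mkord xpredT (fun x => q ^+ x * qsum f x.+1)).
(* The terms with [b <= c] cancel in the difference. *)
rewrite (big_cat_nat (n := c)) //= addrAC subrr add0r.
rewrite -(@sum_ord_interval K c N (fun b => q ^+ b.-1 * qsum f b)) //.
under [RHS]eq_bigr => b bN.
  rewrite /qsum -(big_mkord xpredT (fun a => q ^+ a * f a.+1)).
  rewrite -(@sum_ord_interval K 0 b (fun a => q ^+ a.-1 * f a)) // mulr_sumr.
  over.
(* The iterated sum has [b] outermost, so the coordinates are swapped. *)
rewrite pair_big_dep /= (reindex_inj (inv_inj (f := fun x => (x.2, x.1)) _)) /=.
  apply: eq_big => [[b a]|[b a] _] /=; last by rewrite exprD mulrCA mulrA.
  by rewrite andbCA !andbA; lia.
by case.
Qed.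

Definition ffun_cons (A : finType) n (x : A) (g : {ffun 'I_n -> A}) :
    {ffun 'I_n.+1 -> A} :=
  [ffun i => oapp g x (unlift ord0 i)].

Lemma ffun_cons0 (A : finType) n (x : A) (g : {ffun 'I_n -> A}) :
  ffun_cons x g ord0 = x.
Proof. by rewrite ffunE unlift_none. Qed.

Lemma ffun_consS (A : finType) n (x : A) (g : {ffun 'I_n -> A}) i :
  ffun_cons x g (lift ord0 i) = g i.
Proof. by rewrite ffunE liftK. Qed.

Lemma ffun_cons_bij (A : finType) n :
  bijective (fun p : A * {ffun 'I_n -> A} => ffun_cons p.1 p.2).
Proof.
exists (fun T : {ffun 'I_n.+1 -> A} => (T ord0, [ffun i => T (lift ord0 i)])).
  move=> [x g] /=; rewrite ffun_cons0; congr (_, _).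
  by apply/ffunP => i; rewrite ffunE ffun_consS.
move=> T; apply/ffunP => i; case: (unliftP ord0 i) => [j|] ->.
  by rewrite ffun_consS ffunE.
by rewrite ffun_cons0.
Qed.

Lemma rows_cons K n N c (x : 'I_K * 'I_K) (g : {ffun 'I_n -> 'I_K * 'I_K}) :
  rows N c (ffun_cons x g)
  = [&& (0 < x.1)%N, (x.1 <= x.2)%N, (x.2 <= N)%N & (c < x.2)%N]
    && rows N.+1 x.1 g.
Proof.
have lift_val (i : 'I_n) : lift ord0 i = i.+1 :> nat by [].
apply/idP/idP.
  case/and3P => /forallP R /forallP C /forallP Z.
  have := R ord0; have := Z ord0; rewrite ffun_cons0 addn0 /= => -> /and3P[-> -> ->] /=.
  apply/and3P; split; apply/forallP => i.
  - by have := R (lift ord0 i); rewrite ffun_consS lift_val addSnnS.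
  - apply/forallP => j; have /forallP/(_ (lift ord0 j)) := C (lift ord0 i).
    by rewrite !ffun_consS !lift_val.
  - have /forallP/(_ (lift ord0 i)) := C ord0.
    by rewrite ffun_consS ffun_cons0 lift_val.
case/andP => /and4P[x0 x12 xN cx] /and3P[/forallP R /forallP C /forallP Z].
apply/and3P; split; apply/forallP => i.
- case: (unliftP ord0 i) => [j|] ->; last by rewrite ffun_cons0 addn0 x0 x12.
  by have := R j; rewrite ffun_consS lift_val addSnnS.
- apply/forallP => j; case: (unliftP ord0 j) => [j'|] -> //.
  case: (unliftP ord0 i) => [i'|] ->; rewrite !ffun_consS lift_val.
    by have /forallP/(_ j') := C i'; rewrite lift_val.
  by rewrite ffun_cons0; apply: Z.
- case: (unliftP ord0 i) => [j|] -> //; by rewrite ffun_cons0 cx implybT.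
Qed.

Lemma row_sumE K n N c : (c <= N)%N -> (N + n <= K)%N ->
  row_sum n N c
  = \sum_(T : {ffun 'I_n -> 'I_K * 'I_K} | rows N c T)
      \prod_(i < n) q ^+ ((T i).1.-1 + (T i).2.-1).
Proof.
elim: n N c => [|n IH] N c cN NK.
  (* With no rows, the empty filling is the only one. *)
  rewrite (big_pred1 [ffun i : 'I_0 => False_rect _ (notF (ltn_ord i))]).
    by rewrite big_ord0.
  move=> T; rewrite pred1E; apply/idP/eqP => [_|_].
    by apply/ffunP => -[].
  by apply/and3P; split; apply/forallP => -[].
rewrite [LHS]/= -(@row_pair_sum K); last by rewrite cN; lia.
rewrite (reindex _ (onW_bij _ (@ffun_cons_bij _ n))) /=.
transitivity (\sum_(x : 'I_K * 'I_K | [&& (0 < x.1)%N, (x.1 <= x.2)%N,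
      (x.2 <= N)%N & (c < x.2)%N])
    \sum_(g : {ffun 'I_n -> 'I_K * 'I_K} | rows N.+1 x.1 g)
      q ^+ (x.1.-1 + x.2.-1) * \prod_(i < n) q ^+ ((g i).1.-1 + (g i).2.-1));
  last first.
  rewrite pair_big_dep; apply: eq_big => [p|p _] /=; first by rewrite rows_cons.
  rewrite big_ord_recl ffun_cons0; congr (_ * _).
  by apply: eq_bigr => i _; rewrite ffun_consS.
apply: eq_bigr => x /and4P[_ x12 xN _].
by rewrite IH ?mulr_sumr //; lia.
Qed.

End QSum.

Theorem theorem10 (d : nat -> nat -> Qq) (k l : nat) :
  ltinverse (Hq qvar) (fun i j : nat => (-1) ^ (i%:Z - j%:Z) * d i j) ->
  (1 <= l)%N -> (l <= k)%N ->
  d k l = \sum_(T in Ttilde k l)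
            qvar ^ (- (2 * (k%:Z - l%:Z)) + (weight T)%:Z).
Proof.
move=> dinv l0 lk.
rewrite (ltinverse_row_sum qvar_neq0 qvar_exp_neq1 dinv) ?l0 //.
rewrite (@row_sumE _ _ k) ?subnKC //; apply: eq_big => [T|T].
  rewrite inE /rows; case: [forall i, _] / forallP => //= R.
  (* For [c = 0] the condition on the first row follows from [0 < a <= b]. *)
  rewrite [X in _ && X]( _ : _ = true) ?andbT //; apply/forallP => i.
  by have /and3P[a0 ab _] := R i; rewrite (leq_trans a0 ab) implybT.
case/and3P => /forallP R _ _; rewrite prodrXr exprnP; congr (_ ^ _).
(* Each of the [2 * (k - l)] entries is positive and counted with its predecessor, which accounts
   for the shift of the exponent. *)
have -> : k%:Z - l%:Z = (\sum_(i < k - l) 1)%N%:Z.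
  by rewrite sum1_card card_ord subzn.
rewrite /weight; apply/eqP; rewrite eq_sym addrC subr_eq; apply/eqP.
rewrite -[2]/(2%:Z) -PoszM -PoszD; congr Posz.
rewrite big_distrr -big_split /=; apply: eq_bigr => i _.
by have /and3P[a0 ab _] := R i; lia.
Qed.
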